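(* The pair $(\{P_k(x;y)\}_{k=0}^\infty,\{(2k)!\}_{k=0}^\infty)$ is a palindromic pair with degree $\frac n2$. Namely, let $n\in2\mathbb{Z}_{\ge0}$ and $s\in\mathscr{S}_{\frac{n+2}{2}}(P;n)$. Then $P_k(s;n)=0$ for $k\ge\frac{n+2}{2}$, and $$\frac{P_k(s;n)}{(2k)!}=\theta_{(P;n)}(s)\,\frac{P_{\frac n2-k}(s;n)}{(n-2k)!}\qquad\text{for } k\le\tfrac n2 .$$ Equivalently, for $k\le\frac n2$ this palindromic identity is given as follows. (1) If $n\equiv0\pmod4$: $\displaystyle\frac{P_k(s;n)}{(2k)!}=\frac{P_{\frac n2-k}(s;n)}{(n-2k)!}$ for all $s\in\mathbb{C}$. (2) If $n\equiv2\pmod4$: $\displaystyle\frac{P_k(s;n)}{(2k)!}=\mathrm{sgn}(s)\frac{P_{\frac n2-k}(s;n)}{(n-2k)!}$ for $s\in I_2^+\cup I_2^-$.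
   Context: Palindromic pairs. Let $\{p_k(x;y)\}_{k=0}^\infty$ be a sequence of polynomials in two variables with $p_0(x;y)=1$, $\{a_k\}_{k=0}^\infty$ a sequence of non-zero numbers, and $d\colon\mathbb{Z}_{\ge0}\to\mathbb{R}$ a map. For $n\in\mathbb{Z}_{\ge0}$ put $\mathscr{S}_k(p;n)=\{s\in\mathbb{C}:p_k(s;n)=0\}$. The pair $(\{p_k\},\{a_k\})$ is a palindromic pair with degree $d(n)$ if, for each $n\in\mathbb{Z}_{\ge 0}$ with $d(n)\in\mathbb{Z}_{\ge0}$, there exists a map $\theta_{(p;n)}\colon\mathscr{S}_{d(n)+1}(p;n)\to\{\pm1\}$ such that for all $s\in\mathscr{S}_{d(n)+1}(p;n)$ we have $p_k(s;n)=0$ for $k\ge d(n)+1$ and $\frac{p_k(s;n)}{a_k}=\theta_{(p;n)}(s)\frac{p_{d(n)-k}(s;n)}{a_{d(n)-k}}$ for $0\le k\le d(n)$. The polynomials. Put $a(x)=2x(2x-1)$. $P_0(x;y)=1$, and for $k\ge1$, $P_k(x;y)$ is the determinant of the $k\times k$ tridiagonal matrix with diagonal entries $(y-4(i-1))x$ in position $(i,i)$ $(1\le i\le k)$, entries $a(i)$ in position $(i,i+1)$, and entries $-a\left(\frac{y-2i+2}{2}\right)$ in position $(i+1,i)$ $(1\le i\le k-1)$. $I_2^\pm=\{\pm(1+4j):j=0,1,\ldots,[\frac n4]\}$. For $n\in2\mathbb{Z}_{\ge0}$ one has $\mathscr{S}_{\frac{n+2}{2}}(P;n)=\mathbb{C}$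 if $n\equiv0\pmod4$ and $\mathscr{S}_{\frac{n+2}{2}}(P;n)=I_2^+\cup I_2^-$ if $n\equiv2\pmod4$. The map $\theta_{(P;n)}$ on this set is $\theta_{(P;n)}(s)=1$ if $n\equiv0\pmod4$ and $\theta_{(P;n)}(s)=\mathrm{sgn}(s)$ if $n\equiv2\pmod4$, where $\mathrm{sgn}(s)=\pm1$ is the sign of the non-zero real number $s$. *)

(* Defs.v *)
From mathcomp Require Import all_boot all_order all_algebra.
From mathcomp Require Import boolp classical_sets functions reals.
From mathcomp Require Import complex.

Set Implicit Arguments.
Unset Strict Implicit.
Unset Printing Implicit Defensive.

Import Order.TTheory GRing.Theory Num.Theory.

Local Open Scope classical_set_scope.
Local Open Scope ring_scope.

(* A polynomial p(x;y) is an element of {poly {poly R[i]}}: x is the outer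
   variable 'X and y is the inner one 'Y, so that p(s;t) is p.[s, t]. *)

Definition zeros (R : realType) (p : nat -> {poly {poly R[i]}}) (k n : nat) :
    set R[i] :=
  [set s | (p k).[s, n%:R] = 0].

(* theta is a total function of which only the values on zeros p m.+1 n are
   constrained; m is the natural number d n. *)
Definition palindromic_pair (R : realType) (p : nat -> {poly {poly R[i]}})
    (a : nat -> R[i]) (d : nat -> R) : Prop :=
  [/\ p 0%N = 1,
      forall k, a k != 0 &
      forall n m : nat, d n = m%:R ->
      exists theta : R[i] -> R[i],
        set_fun (zeros p m.+1 n) [set 1; -1] theta /\
        forall s, zeros p m.+1 n s ->
          (forall k, (m.+1 <= k)%N -> (p k).[s, n%:R] = 0) /\
          (forall k, (k <= m)%N ->
             (p k).[s, n%:R] / a k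
             = theta s * ((p (m - k)%N).[s, n%:R] / a (m - k)%N))].

Definition afun (A : pzRingType) (x : A) : A := 2 * x * (2 * x - 1).

(* Rows and columns are numbered from 0, so the paper's index i is i.+1 here. *)
Definition Pmx (R : realType) (k : nat) : 'M[{poly {poly R[i]}}]_k :=
  \matrix_(i < k, j < k)
    if j == i :> nat then ('Y - (4 * (i.+1 - 1))%:R) * 'X
    else if j == i.+1 :> nat then afun i.+1%:R
    else if i == j.+1 :> nat then - afun (('Y - (2 * j.+1)%:R + 2) / 2)
    else 0.

Definition P (R : realType) (k : nat) : {poly {poly R[i]}} := \det (Pmx R k).

Lemma P0 (R : realType) : P R 0 = 1.
Proof. exact: det_mx00. Qed.

(* The division by 2 in Pmx is a genuine one. *)
Lemma unit2_polyXY (R : realType) : (2 : {poly {poly R[i]}}) \is a GRing.unit.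
Proof.
have -> : (2 : {poly {poly R[i]}}) = (2%:P)%:P by rewrite !rmorph_nat.
by do 2!apply: rmorph_unit; rewrite unitfE pnatr_eq0.
Qed.

Definition I2plus (R : realType) (n : nat) : set R[i] :=
  [set s | exists2 j : nat, (j <= n %/ 4)%N & s = (1 + 4 * j)%:R].

Definition I2minus (R : realType) (n : nat) : set R[i] :=
  [set s | exists2 j : nat, (j <= n %/ 4)%N & s = - (1 + 4 * j)%:R].

Arguments I2plus : clear implicits.
Arguments I2minus : clear implicits.

(* Num.sg on R[i] is the usual sign on real elements: the order of R[i] extends
   that of R, and Num.sg s is 0 if s = 0, -1 if s < 0, and 1 otherwise. It is
   only meant for the non-zero real numbers s of I2plus and I2minus. *)
Definition thetaP (R : realType) (n : nat) (s : R[i]) : R[i] :=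
  if n == 0 %[mod 4] then 1 else Num.sg s.

(* Main.v *)
Require Import Defs.
From HB Require Import structures.
From mathcomp Require Import all_boot all_order all_algebra.
From mathcomp Require Import boolp classical_sets functions reals.
From mathcomp Require Import complex.
From mathcomp Require Import ring zify.

(** Fix n = 2m and put q_k = P_k(s;n)/(2k)! and c(x) = 2x(2x-1). Expanding the
tridiagonal determinant along its last row turns the definition of P_k into
  c(k+2) q_(k+2) = 2(m-2(k+1)) s q_(k+1) + c(m-k) q_k,   q_1 = m s q_0
(lemma [mirror_rec_P]). Under k |-> m-k the coefficients c(k+2) and c(m-k)
trade places and the middle coefficient changes sign, so the reversed sequence
obeys the same recurrence away from its ends. Everything follows from this
mirror symmetry.

If q_(m+1) = 0, the recurrence also holds for the reversed sequence at its end,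
hence q_(m-k) = q_m q_k ([mirror_end]); taking k = m gives q_m^2 = 1, and
theta(s) = q_m. Moreover c(0) = 0 makes all q_k with k > m vanish
([mirror_tail]). It remains to find the zeros s of q_(m+1) and the sign q_m.

For m even the middle coefficient vanishes at k + 1 = m/2, which makes q
symmetric about m/2 at the first step and so everywhere: q_m = 1 and
q_(m+1) = 0 for every s ([mirror_even]).

For m odd, let t be a formal variable. The recurrence says that
f = sum_k q_k t^(2k) solves a second order differential equation, which in
terms of the sl_2-operators
  X f = (1-t^2) f' + n t f,   Y f = (1+t^2) f' - n t f
on polynomials of degree at most n reads (1+s) X Y f = (s-1) Y X f
([pencil_coef_rec]). The polynomials (1+t)^a (1-t)^b, a+b = n, diagonalize X,
and Y moves a by one step up or down, so in this basis the equation becomes a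
two-term recurrence, solvable in closed form. When s = 1 + 2d with d even and
d < m, a coefficient of this recurrence vanishes at i = (m-1-d)/2, where a = 2i,
and the solution that stops there is a nonzero combination of the
(1+t)^(2i) (1-t)^(n-2i) with natural coefficients ([genpoly]). Its value at
t = 0 is positive, its degree is at most n, and its coefficient of t^n equals
the one of t^0; since its even coefficients obey the recurrence, they are a
multiple of q, whence q_(m+1) = 0 and q_m = 1 for these s ([mirror_genpoly]).
The parity q_k(-s) = (-1)^k q_k(s) gives the opposite values of s, with
q_m = -1. These are m+1 zeros of the polynomial q_(m+1), which has degree m+1
in s because the coefficients 2(m-2(k+1)) do not vanish for m odd: there are no
other zeros ([mirror_odd_zeros]). *)

Set Implicit Arguments.
Unset Strict Implicit.
Unset Printing Implicit Defensive.

Import Order.TTheory GRing.Theory Num.Theory.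

Local Open Scope classical_set_scope.
Local Open Scope ring_scope.

(** * Tridiagonal determinants *)

Definition tridiag (A : comNzRingType) (d u l : nat -> A) (k : nat) : 'M[A]_k :=
  \matrix_(i, j) if j == i :> nat then d i
                 else if j == i.+1 :> nat then u i
                 else if i == j.+1 :> nat then l j else 0.

(** Two successive expansions, along the last row and then along the last
column of the minor that remains: the only product of two off-diagonal entries
that survives is u k * l k, with a minus sign. *)
Lemma det_tridiag (A : comNzRingType) (d u l : nat -> A) k :
  \det (tridiag d u l k.+2)
  = d k.+1 * \det (tridiag d u l k.+1) - u k * l k * \det (tridiag d u l k).
Proof.
rewrite (expand_det_row _ ord_max) big_ord_recr big_ord_recr /=.
rewrite [X in X + _ + _]big1 => [|i _]; last first.
  have hi := ltn_ord i; rewrite mxE /=.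
  by rewrite ifF ?ifF ?ifF ?mul0r //; lia.
rewrite add0r addrC; congr (_ + _).
  rewrite mxE eqxx /cofactor addnn -signr_odd odd_double expr0 mul1r.
  congr (_ * \det _); apply/matrixP=> i j; rewrite !mxE /= /bump.
  by rewrite [(k.+1 <= i)%N]leqNgt [(k.+1 <= j)%N]leqNgt !ltn_ord.
rewrite mxE /= ifF; last by lia.
rewrite ifF; last by lia.
rewrite eqxx /cofactor /= addSn addnn -signr_odd /= odd_double expr1.
rewrite mulN1r mulrN [u k * _]mulrC -mulrA; congr (- (_ * _)).
rewrite (expand_det_col _ ord_max) big_ord_recr /=.
rewrite [X in X + _]big1 ?add0r => [|i _]; last first.
  have hi := ltn_ord i; rewrite !mxE /= /bump.
  by rewrite ifF ?ifF ?ifF ?mul0r //; lia.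
rewrite !mxE /= /bump ifF; last by lia.
rewrite ifT; last by lia.
rewrite /cofactor addnn -signr_odd odd_double expr0 mul1r.
have -> : ((k.+1 <= k) + k)%N = k by lia.
congr (_ * \det _); apply/matrixP=> i j; rewrite !mxE /= /bump.
have hi := ltn_ord i; have hj := ltn_ord j.
have -> : (k <= i)%N = false by lia.
have -> : (k <= j)%N = false by lia.
rewrite !add0n.
have -> : (k < i)%N = false by lia.
by have -> : (k <= j)%N = false by lia.
Qed.

(** * The three-term recurrence of the polynomials P *)

Lemma afun_half (R : realType) (z : {poly {poly R[i]}}) :
  afun (z / 2) = z * (z - 1).
Proof. by rewrite /afun [2 * _]mulrC divrK ?unit2_polyXY. Qed.

Lemma P1 (R : realType) : P R 1 = 'Y * 'X.
Proof. by rewrite /P det_mx11 mxE /= muln0 subr0. Qed.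

Lemma P_rec (R : realType) k : P R k.+2 =
  ('Y - (4 * k.+1)%:R) * 'X * P R k.+1
  + afun k.+1%:R * (('Y - (2 * k)%:R) * ('Y - (2 * k)%:R - 1)) * P R k.
Proof.
pose d i : {poly {poly R[i]}} := ('Y - (4 * (i.+1 - 1))%:R) * 'X.
pose u i : {poly {poly R[i]}} := afun i.+1%:R.
pose l j : {poly {poly R[i]}} := - afun (('Y - (2 * j.+1)%:R + 2) / 2).
have -> : P R k.+2 = \det (tridiag d u l k.+2) by [].
rewrite det_tridiag /d /u /l afun_half subn1 mulrN mulNr opprK.
congr (_ + afun _ * _ * _).
by have -> : 'Y - (2 * k.+1)%:R + 2 = 'Y - (2 * k)%:R :> {poly {poly R[i]}}
  by rewrite mulnS natrD; ring.
Qed.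

Lemma rmorph_afun (A B : pzRingType) (f : {rmorphism A -> B}) (x : A) :
  f (afun x) = afun (f x).
Proof. by rewrite /afun rmorphM rmorphB rmorphM rmorph_nat rmorph1. Qed.

Lemma horner_P_rec (R : realType) k (s y : R[i]) :
  (P R k.+2).[s, y] = (y - (4 * k.+1)%:R) * s * (P R k.+1).[s, y]
  + afun k.+1%:R * ((y - (2 * k)%:R) * (y - (2 * k)%:R - 1)) * (P R k).[s, y].
Proof.
have [ev evE [evX evY]] : exists2 ev : {rmorphism {poly {poly R[i]}} -> R[i]},
    forall p, p.[s, y] = ev p & ev 'X = s /\ ev 'Y = y.
  exists (horner_eval y \o horner_eval s%:P) => //.
  by rewrite /= /horner_eval !hornerE.
rewrite !evE P_rec.
rewrite !(rmorph_nat, rmorph_afun, rmorph1, rmorphB, rmorphM, rmorphD).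
by rewrite evX evY.
Qed.

Lemma horner_P0 (R : realType) (s y : R[i]) : (P R 0).[s, y] = 1.
Proof. by rewrite P0 !hornerE. Qed.

Lemma horner_P1 (R : realType) (s y : R[i]) : (P R 1).[s, y] = y * s.
Proof. by rewrite P1 !hornerE. Qed.

Lemma factS2 (F : numFieldType) j :
  ((2 * j.+1)`!)%:R = afun j.+1%:R * ((2 * j)`!)%:R :> F.
Proof.
have -> : afun j.+1%:R = (2 * j).+2%:R * (2 * j).+1%:R :> F.
  by rewrite /afun -!natr1 natrM; ring.
have -> : (2 * j.+1 = (2 * j).+2)%N by lia.
by rewrite 2![in LHS]factS !natrM mulrA.
Qed.

Lemma afun_neq0 (F : numFieldType) j : afun j.+1%:R != 0 :> F.
Proof.
rewrite /afun mulf_neq0 ?mulf_neq0 ?pnatr_eq0 //.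
by rewrite -natrM subr_eq0 pnatr_eq1; lia.
Qed.

(** The recurrence of P_k(s;2m)/(2k)!. Subtraction is in F, so that the last
coefficient is meaningful for k > m, and vanishes at k = m. *)
Definition mirror_rec (F : numFieldType) (m : nat) (s : F) (q : nat -> F) :=
  q 1%N = m%:R * s * q 0%N /\
  forall k, afun k.+2%:R * q k.+2
            = 2 * (m%:R - 2 * k.+1%:R) * s * q k.+1
              + afun (m%:R - k%:R) * q k.

(** The factorials absorb one factor c of the product c(k+1) c(m-k) in the
recurrence of P, which is what makes the normalized recurrence symmetric. *)
Lemma mirror_rec_P (R : realType) (m : nat) (s : R[i]) :
  mirror_rec m s (fun k => (P R k).[s, (2 * m)%:R] / ((2 * k)`!)%:R).
Proof.
split=> [|k].
  rewrite horner_P0 horner_P1 muln0 muln1 fact0 natrM (_ : 2`! = 2)%N //.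
  by field.
have f0 : (2 * k)`!%:R != 0 :> R[i] by rewrite pnatr_eq0 -lt0n fact_gt0.
rewrite horner_P_rec !factS2.
have := afun_neq0 R[i] k; have := afun_neq0 R[i] k.+1; move: f0.
move: (afun k.+1%:R) (afun k.+2%:R) => c1 c2 f0 h1 h2.
rewrite /afun !natrM; field.
by rewrite f0 h1 h2.
Qed.

(** * Mirror symmetry of the recurrence *)

Section Mirror.
Variables (F : numFieldType) (m : nat) (s : F) (q : nat -> F).
Hypothesis qrec : mirror_rec m s q.

(** The recurrences at the mirror positions a and b have opposite middle
coefficients. Adding them with weight e cancels the middle terms and leaves
c(b+2) (q_(b+2) - e q_a) = c(a+2) (q_b - e q_(a+2)). *)
Lemma mirror_step a b e : (a + b).+2 = m -> q b.+1 = e * q a.+1 ->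
  (q b.+2 == e * q a) = (q b == e * q a.+2).
Proof.
move=> abm qe; have [_ r] := qrec.
have ra := r a; have rb := r b.
have ma : m%:R - a%:R = b.+2%:R :> F.
  by rewrite -abm -!addnS natrD addrC addKr.
have mb : m%:R - b%:R = a.+2%:R :> F.
  by rewrite -abm addnC -!addnS natrD addrC addKr.
have mE : m%:R = a.+1%:R + b.+1%:R :> F by rewrite -abm -natrD addSn addnS.
rewrite ma mE in ra; rewrite mb mE qe in rb.
rewrite -subr_eq0 -[RHS]subr_eq0.
rewrite -(mulrI_eq0 _ (mulfI (afun_neq0 F b.+1))).
rewrite -[RHS](mulrI_eq0 _ (mulfI (afun_neq0 F a.+1))).
rewrite !mulrBr rb !(mulrCA _ e) ra.
congr (_ == 0); ring.
Qed.

(** The analogue of [mirror_step] at the ends, where the mirror image of the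
recurrence for q_(m+1) is the initial condition on q_1. *)
Lemma mirror_edge e : (0 < m)%N -> q m = e * q 0%N ->
  (q m.+1 == 0) = (q m.-1 == e * q 1%N).
Proof.
case: m qrec => // n [r1 r] _ /= qm.
have := r n; rewrite qm r1.
have -> : n.+1%:R - n%:R = 1 :> F by rewrite -natr1 addrAC subrr add0r.
have -> : afun 1 = 2 :> F by rewrite /afun; ring.
move=> rn.
rewrite -(mulrI_eq0 _ (mulfI (afun_neq0 F n.+1))) rn.
have t0 : 2 != 0 :> F by rewrite pnatr_eq0.
rewrite -[RHS]subr_eq0 -[RHS](mulrI_eq0 _ (mulfI t0)).
by congr (_ == 0); ring.
Qed.

(** The recurrence at k = m has c(0) = 0 in front of q_m, so that two
consecutive terms vanish from m+1 on. *)
Lemma mirror_tail : q m.+1 = 0 -> forall k, (m < k)%N -> q k = 0.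
Proof.
move=> q0; have [_ r] := qrec.
have H j : q (m.+1 + j)%N = 0 /\ q (m.+1 + j).+1 = 0.
  elim: j => [|j [IH1 IH2]].
    rewrite addn0; split=> //.
    have := r m; rewrite q0 subrr mulr0 add0r /afun mulr0 !mul0r.
    by move/eqP; rewrite mulf_eq0 (negbTE (afun_neq0 _ _)) => /eqP.
  rewrite addnS; split=> //; have := r (m.+1 + j)%N.
  rewrite IH1 IH2 !mulr0 addr0.
  by move/eqP; rewrite mulf_eq0 (negbTE (afun_neq0 _ _)) => /eqP.
by move=> k /subnKC <-; case: (H (k - m.+1)%N).
Qed.

(** The symmetry starts at the ends by [mirror_edge] and moves inwards by
[mirror_step]. *)
Lemma mirror_end : q 0%N = 1 -> q m.+1 = 0 ->
  forall k, (k <= m)%N -> q (m - k)%N = q m * q k.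
Proof.
move=> q0 qm1.
have H k : (k < m)%N ->
    q (m - k)%N = q m * q k /\ q (m - k.+1)%N = q m * q k.+1.
  elim: k => [|k IH] km.
    rewrite subn0 q0 mulr1 subn1; split=> //; apply/eqP.
    by rewrite -(mirror_edge km) ?qm1 ?q0 ?mulr1.
  have [//|IH1 IH2] := IH _; first exact: ltnW.
  split=> //; have abm : (k + (m - k.+2)).+2 = m by lia.
  apply/eqP; rewrite -(mirror_step abm).
    have -> : (m - k.+2).+2 = (m - k)%N by lia.
    by rewrite IH1.
  by have -> : (m - k.+2).+1 = (m - k.+1)%N by lia.
move=> k; rewrite leq_eqVlt => /predU1P[->|/H[]//].
case: (posnP m) => [m0|mp]; first by rewrite m0 q0 mulr1.
by have := H m.-1; rewrite prednK // leqnn => -[].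
Qed.

(** The symmetry starts at the centre, where the middle coefficient is zero and
the two outer ones agree, and moves outwards by [mirror_step]. *)
Lemma mirror_centre h : m = h.*2 ->
  forall j, (j <= h)%N -> q (h + j)%N = q (h - j)%N.
Proof.
move=> mh.
have H j : (j < h)%N ->
    q (h + j)%N = q (h - j)%N /\ q (h + j.+1)%N = q (h - j.+1)%N.
  elim: j => [|j IH] jh.
    rewrite addn0 subn0 addn1 subn1; split=> //.
    have [_ r] := qrec; have := r h.-1; rewrite prednK // mh.
    have -> : h.*2%:R - 2 * h%:R = 0 :> F by rewrite -mul2n natrM subrr.
    have -> : h.*2%:R - h.-1%:R = h.+1%:R :> F.
      by rewrite -natrB; [congr _%:R|]; lia.
    by rewrite mulr0 !mul0r add0r => /(mulfI (afun_neq0 _ _)).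
  have [//|IH1 IH2] := IH _; first exact: ltnW.
  split=> //; have abm : ((h - j.+2) + (h + j)).+2 = m by lia.
  have := @mirror_step _ _ 1 abm.
  have -> : (h - j.+2).+1 = (h - j.+1)%N by lia.
  have -> : (h - j.+1).+1 = (h - j)%N by lia.
  rewrite -!addnS !mul1r IH1 eqxx => /(_ IH2) stepE.
  by apply/eqP; rewrite stepE.
move=> j; rewrite leq_eqVlt => /predU1P[->|/H[]//].
case: (posnP h) => [h0|hp]; first by rewrite h0 addn0 subn0.
by have := H h.-1; rewrite prednK // leqnn => -[].
Qed.

Lemma mirror_even : q 0%N = 1 -> ~~ odd m -> q m = 1 /\ q m.+1 = 0.
Proof.
move=> q0 mev; have mh : m = m./2.*2 by rewrite even_halfK.
have qm : q m = 1.
  by have := mirror_centre mh (leqnn _); rewrite addnn -mh subnn q0.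
split=> //; case: (posnP m) => [m0|mpos].
  move: qrec q0; rewrite m0 => -[-> _] _; by rewrite mulr0n !mul0r.
apply/eqP; rewrite (mirror_edge mpos (e := 1)) ?q0 ?qm ?mul1r //; apply/eqP.
have := @mirror_centre _ mh (m./2.-1); rewrite leq_pred => /(_ isT).
have -> : (m./2 + m./2.-1 = m.-1)%N by lia.
by have -> : (m./2 - m./2.-1 = 1)%N by lia.
Qed.

(** The leading coefficients c(k+2) never vanish, so the initial value
determines the sequence. *)
Lemma mirror_rec_uniq u : q 0%N = 1 -> mirror_rec m s u ->
  forall k, u k = u 0%N * q k.
Proof.
move=> q0 [u1 ur]; have [q1 r] := qrec.
have H k : u k = u 0%N * q k /\ u k.+1 = u 0%N * q k.+1.
  elim: k => [|k [IH1 IH2]]; first by rewrite u1 q1 q0; split; ring.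
  split=> //; apply: (mulfI (afun_neq0 F k.+1)).
  by rewrite ur [in RHS]mulrCA r IH1 IH2; ring.
by move=> k; case: (H k).
Qed.

Lemma mirror_rec_opp : mirror_rec m (- s) (fun k => (-1) ^+ k * q k).
Proof.
have [q1 r] := qrec; split=> [|k]; first by rewrite q1; ring.
by rewrite mulrCA r !exprS; ring.
Qed.
End Mirror.

(** * Polynomial solutions of the differential equation *)

Section Generating.
Variable F : numFieldType.
Implicit Types f : {poly F}.

(** The sum and the difference of the raising and lowering operators d/dt and
n t - t^2 d/dt of the representation of sl_2 on polynomials of degree at most
n. *)
Definition opX n f := (1 - 'X^2) * f^`() + n%:R * 'X * f.
Definition opY n f := (1 + 'X^2) * f^`() - n%:R * 'X * f.

(** Half of (1+s) X Y - (s-1) Y X for s = 1 + 2d, which avoids scalars other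
than natural numbers. *)
Definition pencil n d f := d.+1%:R * opX n (opY n f) - d%:R * opY n (opX n f).

Lemma opXB n f g : opX n (f - g) = opX n f - opX n g.
Proof. by rewrite /opX derivB; ring. Qed.

Lemma opYB n f g : opY n (f - g) = opY n f - opY n g.
Proof. by rewrite /opY derivB; ring. Qed.

Lemma opX_natl n k f : opX n (k%:R * f) = k%:R * opX n f.
Proof. by rewrite /opX !mulr_natl derivMn; ring. Qed.

Lemma opY_natl n k f : opY n (k%:R * f) = k%:R * opY n f.
Proof. by rewrite /opY !mulr_natl derivMn; ring. Qed.

Fact pencil_is_zmod_morphism n d : zmod_morphism (pencil n d).
Proof. by move=> f g; rewrite /pencil opYB !opXB opYB; ring. Qed.
HB.instance Definition _ n d :=
  GRing.isZmodMorphism.Build {poly F} {poly F} (pencil n d)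
    (pencil_is_zmod_morphism n d).

Lemma coef_X2deriv f k : ('X^2 * f^`())`_k.+1 = k%:R * f`_k.
Proof.
rewrite coefXnM; case: k => [|k]; first by rewrite mul0r.
by rewrite ltnS /= subSS subn1 coef_deriv mulr_natl.
Qed.

Lemma coef_natXM n f k :
  (n%:R * 'X * f)`_k = n%:R * (if k == 0%N then 0 else f`_k.-1).
Proof. by rewrite -mulrA mulr_natl coefMn coefXM mulr_natl. Qed.

Lemma coef_opX0 n f : (opX n f)`_0 = f`_1.
Proof.
rewrite /opX mulrBl mul1r coefD coefB coefXnM coef_deriv coef_natXM /=.
by ring.
Qed.

Lemma coef_opY0 n f : (opY n f)`_0 = f`_1.
Proof.
rewrite /opY mulrDl mul1r coefB coefD coefXnM coef_deriv coef_natXM /=.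
by ring.
Qed.

Lemma coef_opX n f k :
  (opX n f)`_k.+1 = k.+2%:R * f`_k.+2 + (n%:R - k%:R) * f`_k.
Proof.
rewrite /opX mulrBl mul1r coefD coefB coef_X2deriv coef_deriv coef_natXM /=.
by ring.
Qed.

Lemma coef_opY n f k :
  (opY n f)`_k.+1 = k.+2%:R * f`_k.+2 - (n%:R - k%:R) * f`_k.
Proof.
rewrite /opY mulrDl mul1r coefB coefD coef_X2deriv coef_deriv coef_natXM /=.
by ring.
Qed.

(** The commutator X Y - Y X multiplies t^e by -2(n-2e) and the
anticommutator shifts degrees by two, so the coefficients of even degree
satisfy a three-term recurrence among themselves. *)
Lemma pencil_coef_rec m d f : pencil (2 * m) d f = 0 ->
  mirror_rec m (1 + 2 * d%:R) (fun k => f`_(2 * k)).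
Proof.
move=> Lf.
have coefL k : d.+1%:R * (opX (2 * m) (opY (2 * m) f))`_k
               - d%:R * (opY (2 * m) (opX (2 * m) f))`_k = 0.
  transitivity ((pencil (2 * m) d f)`_k); last by rewrite Lf coef0.
  rewrite /pencil; move: (opX _ (opY _ _)) (opY _ (opX _ _)) => u v.
  by rewrite !mulr_natl coefB !coefMn.
have t0 : 2 != 0 :> F by rewrite pnatr_eq0.
split=> [|k].
  have := coefL 0%N; rewrite coef_opX0 coef_opY0 coef_opX coef_opY.
  rewrite muln0 muln1 -natr1 => L0; apply: (mulfI t0).
  by apply/eqP; rewrite -subr_eq0 -[X in _ == X]L0 !natrM; apply/eqP; ring.
have := coefL (2 * k).+2; rewrite !(coef_opX, coef_opY).
have -> : (2 * k.+1 = (2 * k).+2)%N by lia.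
have -> : (2 * k.+2 = (2 * k).+4)%N by lia.
rewrite /afun => Lk; apply/eqP; rewrite -subr_eq0 -[X in _ == X]Lk.
rewrite -!natr1 !natrM; apply/eqP; ring.
Qed.

(** The eigenvectors of [opX (a + b)], with eigenvalue a - b: they are the
monomials in the sum and the difference of the two homogeneous coordinates. *)
Definition ebasis a b : {poly F} := (1 + 'X) ^+ a * (1 - 'X) ^+ b.

Lemma deriv_basis a b : (ebasis a b)^`() =
  a%:R * ebasis a.-1 b - b%:R * ebasis a b.-1.
Proof.
rewrite /ebasis derivM !deriv_exp !derivE; ring.
Qed.

(** Clears the truncated exponent that derivatives of powers create. *)
Lemma natmul_predX (A : comNzRingType) (x : A) a :
  a%:R * x ^+ a.-1 * x = a%:R * x ^+ a.
Proof. by case: a => [|a] /=; rewrite ?mul0r // exprSr mulrA. Qed.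

Lemma opX_basis a b : opX (a + b) (ebasis a b) = (a%:R - b%:R) * ebasis a b.
Proof.
rewrite /opX deriv_basis /ebasis mulrBr.
have ha := natmul_predX (1 + 'X : {poly F}) a.
have hb := natmul_predX (1 - 'X : {poly F}) b.
set x := 'X in ha hb *.
transitivity ((a%:R * (1 + x) ^+ a.-1 * (1 + x)) * ((1 - x) ^+ b * (1 - x))
  - (b%:R * (1 - x) ^+ b.-1 * (1 - x)) * ((1 + x) ^+ a * (1 + x))
  + (a + b)%:R * x * ((1 + x) ^+ a * (1 - x) ^+ b)).
  by ring.
by rewrite ha hb natrD; ring.
Qed.

(** As b.+1 > 0, the only boundary case is a = 0, where the coefficient a
makes the value of [a.-1] immaterial. *)
Lemma opY_basis a b : opY (a + b.+1) (ebasis a b.+1) =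
  a%:R * ebasis a.-1 b.+2 - b.+1%:R * ebasis a.+1 b.
Proof.
rewrite /opY deriv_basis /ebasis /=.
case: a => [|a] /=; rewrite !exprS natrD; ring.
Qed.

Lemma pencil_basis n d a b : (a + b.+1)%N = n -> pencil n d (ebasis a b.+1) =
  a%:R * (a%:R - b.+1%:R - 2 - 2 * d%:R) * ebasis a.-1 b.+2
  - b.+1%:R * (a%:R - b.+1%:R + 2 + 2 * d%:R) * ebasis a.+1 b.
Proof.
move=> <-; rewrite /pencil opX_basis opY_basis mulrBl opXB opYB.
rewrite !opX_natl !opY_natl opY_basis; have -> : (a + b.+1 = a.+1 + b)%N by lia.
rewrite opX_basis.
case: a => [|a]; first by rewrite !mulr0n; ring.
have -> : (a.+2 + b = a + b.+2)%N by lia.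
by rewrite /= opX_basis; ring.
Qed.

(** Up to the constant factor M!, this is the hypergeometric term
C(m,i) C(N,i) / C(M,i); clearing the denominator keeps it a natural number. It
is positive at i = 0 and vanishes for i > N. *)
Definition weight m N M i := ('C(m, i) * N ^_ i * (M - i)`!)%N.

Lemma weight_step m N M i : (i <= N)%N -> (N <= M)%N ->
  (i.+1 * (M - i) * weight m N M i.+1 = (m - i) * (N - i) * weight m N M i)%N.
Proof.
move=> iN NM; rewrite /weight ffactnSr.
have bE := mul_bin_left m i.
have fE : ((M - i)`! * (N - i) = (M - i) * (M - i.+1)`! * (N - i))%N.
  have [iN'|Ni] := ltnP i N.
    congr (_ * _)%N; rewrite subnS.
    have: (0 < M - i)%N by lia.
    by case: (M - i)%N => // x _; rewrite factS.
  have -> : (N - i = 0)%N by lia.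
  by rewrite !muln0.
transitivity (i.+1 * 'C(m, i.+1) * N ^_ i
              * ((M - i) * (M - i.+1)`! * (N - i)))%N; first by ring.
by rewrite bE -fE; ring.
Qed.

Lemma pencil_basis_even N d i : (i <= N)%N ->
  let m := (2 * N + d).+1 in
  pencil (2 * m) d (ebasis (2 * i) (2 * (m - i)))
  = 8%:R * ((m - i)%:R * (N - i)%:R * ebasis (2 * i).+1 (2 * (m - i)).-1
            - i%:R * ((N + d).+1 - i)%:R * ebasis (2 * i).-1 (2 * (m - i)).+1).
Proof.
move=> iN m; have im : (i < m)%N by rewrite /m; lia.
have -> : (2 * (m - i) = (2 * (m - i)).-1.+1)%N by lia.
rewrite pencil_basis; last by lia.
have -> : (2 * (m - i)).-1.+1%:R = 2 * (m - i)%:R :> {poly F}.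
  by rewrite prednK ?muln_gt0 ?subn_gt0 // natrM.
rewrite (natrB _ (ltnW im)) (natrB _ iN) natrB; last by lia.
rewrite /m /=; ring.
Qed.

(** The solution of the two-term recurrence for s = 1 + 2d and m = 2N+d+1; it
stops at i = N, where the factor N-i of [pencil_basis_even] vanishes. *)
Definition genpoly N d : {poly F} :=
  let m := (2 * N + d).+1 in
  \sum_(0 <= i < N.+1) ebasis (2 * i) (2 * (m - i)) *+ weight m N (N + d) i.

(** By [pencil_basis_even] and [weight_step], the images of the summands
telescope; the last term vanishes because the weight does beyond N. *)
Lemma pencil_genpoly N d : pencil (2 * (2 * N + d).+1) d (genpoly N d) = 0.
Proof.
rewrite /genpoly; set m := (2 * N + d).+1; set M := (N + d)%N.
(* T i is 1/8 of the component of the image of the i-th summand on the lower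
   neighbour, with its sign changed. *)
pose T i : {poly F} := (i * (M.+1 - i) * weight m N M i)%:R
                       * ebasis (2 * i).-1 (2 * (m - i)).+1.
rewrite raddf_sum /=.
rewrite (eq_big_nat _ _ (F2 := fun i => 8%:R * (T i.+1 - T i)))
  => [|i /andP[_ iN]].
  rewrite -mulr_sumr telescope_sumr // /T /weight ffact_small //.
  by rewrite !(muln0, mul0n) !mul0r subr0 mulr0.
rewrite raddfMn /= pencil_basis_even // /T subSS weight_step //;
  last by rewrite leq_addr.
have -> : (2 * i.+1).-1 = (2 * i).+1 by lia.
have -> : (2 * (m - i.+1)).+1 = (2 * (m - i)).-1 by rewrite /m; lia.
rewrite -[LHS]mulr_natr -/m -/M; ring.
Qed.

(** Exhibits the degree and the top coefficient. *)
Lemma basis_monic a b : ebasis a b =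
  (-1) ^+ b *: (('X - (-1)%:P) ^+ a * ('X - 1%:P) ^+ b).
Proof.
rewrite -mul_polyC polyC_exp !polyCN polyC1 opprK mulrCA /ebasis.
by rewrite [1 + 'X]addrC -[1 - 'X]opprB [(- _) ^+ b]exprNn.
Qed.

Lemma size_basis a b : size (ebasis a b) = (a + b).+1.
Proof.
rewrite basis_monic size_scale ?signr_eq0 //.
rewrite size_monicM ?monic_exp ?monicXsubC ?expf_neq0 ?polyXsubC_eq0 //.
by rewrite !size_exp_XsubC addSn addnS.
Qed.

Lemma coef0_basis a b : (ebasis a b)`_0 = 1.
Proof.
by rewrite -horner_coef0 /ebasis !hornerE /= ?addr0 ?subr0 !expr1n ?mulr1.
Qed.

Lemma coef_top_basis a b : (ebasis a b)`_(a + b) = (-1) ^+ b.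
Proof.
have -> : (a + b)%N = (size (ebasis a b)).-1 by rewrite size_basis.
rewrite -lead_coefE basis_monic lead_coefZ (monicP _) ?mulr1 //.
by rewrite monicMl monic_exp ?monicXsubC.
Qed.

(** The top coefficient of each summand is a power of -1 with even exponent
2(m-i), hence equal to its constant term; the constant term of the sum is a sum
of natural numbers with a positive first term. *)
Lemma coef_genpoly N d : let m := (2 * N + d).+1 in
  [/\ (genpoly N d)`_0 != 0, (genpoly N d)`_(2 * m) = (genpoly N d)`_0
    & (genpoly N d)`_(2 * m.+1) = 0].
Proof.
move=> m; split.
- rewrite coef_sum (eq_bigr (fun i => (weight m N (N + d) i)%:R))
    => [|i _]; last by rewrite coefMn coef0_basis.
  rewrite -natr_sum pnatr_eq0 big_nat_recl //= /weight bin0 ffactn0 !mul1n.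
  by rewrite -lt0n addn_gt0 fact_gt0.
- rewrite !coef_sum; apply: eq_big_nat => i /andP[_ iN].
  have im : (2 * i <= 2 * m)%N by rewrite /m; lia.
  rewrite !coefMn coef0_basis -[in X in _`_X](subnKC im).
  by rewrite -mulnBr coef_top_basis exprM sqrrN !expr1n.
- rewrite coef_sum big_nat big1 // => i /andP[_ iN].
  by rewrite coefMn nth_default ?mul0rn // size_basis /m; lia.
Qed.

(** The even coefficients of [genpoly] are a nonzero multiple of q. *)
Lemma mirror_genpoly N d (q : nat -> F) : let m := (2 * N + d).+1 in
  mirror_rec m (1 + 2 * d%:R) q -> q 0%N = 1 -> q m = 1 /\ q m.+1 = 0.
Proof.
move=> m qrec q0; have [g0 gm gm1] := coef_genpoly N d.
have gE := mirror_rec_uniq qrec q0 (pencil_coef_rec (pencil_genpoly N d)).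
split; apply: (mulfI g0).
  by rewrite mulr1 -[RHS]gm (gE m) muln0.
by rewrite mulr0 -[RHS]gm1 (gE m.+1) muln0.
Qed.
End Generating.

(** * Zeros and signs for odd m *)

(** The negative values of s reduce to the positive ones by [mirror_rec_opp],
where the sign (-1)^m = -1 enters. *)
Lemma mirror_odd_spectrum (F : numFieldType) m j (q : nat -> F) :
  odd m -> (j <= m./2)%N -> q 0%N = 1 ->
  (mirror_rec m (1 + 4 * j)%:R q -> q m = 1 /\ q m.+1 = 0) /\
  (mirror_rec m (- (1 + 4 * j)%:R) q -> q m = -1 /\ q m.+1 = 0).
Proof.
move=> modd jm q0.
(* [mirror_genpoly] applies with d = 2j and N = (m-1)/2 - j. *)
have mE : m = (2 * (m./2 - j) + 2 * j).+1 by lia.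
have sE : (1 + 4 * j)%:R = 1 + 2 * (2 * j)%:R :> F by ring.
split=> qrec; rewrite sE mE in qrec; first by rewrite mE; apply: mirror_genpoly.
have := mirror_rec_opp qrec; rewrite opprK => /mirror_genpoly.
have sgnm : (-1) ^+ m = -1 :> F by rewrite -signr_odd modd.
rewrite expr0 mul1r -mE exprS sgnm mulN1r mulrNN !mul1r => /(_ q0)[qm qm1].
by split; first by rewrite -[LHS]opprK qm.
Qed.

(** For odd m the factor m - 2(k+1) is never zero, so each step of the
recurrence raises the degree in s by exactly one. *)
Lemma mirror_poly (F : numFieldType) m (q : F -> nat -> F) :
  odd m -> (forall s, mirror_rec m s (q s)) -> (forall s, q s 0%N = 1) ->
  forall k, exists2 Q : {poly F}, size Q = k.+1 & forall s, Q.[s] = q s k.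
Proof.
move=> modd qrec q0.
have H k : (exists2 Q : {poly F}, size Q = k.+1 & forall s, Q.[s] = q s k) /\
  (exists2 Q : {poly F}, size Q = k.+2 & forall s, Q.[s] = q s k.+1).
  elim: k => [|k [[Q sQ QE] [Q' sQ' QE']]]; split.
  - by exists 1; [rewrite size_poly1 | move=> s; rewrite hornerC q0].
  - have m0 : m%:R != 0 :> F by rewrite pnatr_eq0; lia.
    exists (m%:R *: 'X); first by rewrite size_scale // size_polyX.
    by move=> s; rewrite hornerZ hornerX; have [-> _] := qrec s;
      rewrite q0 mulr1.
  - by exists Q'.
  have c0 : 2 * (m%:R - 2 * k.+1%:R) != 0 :> F.
    rewrite mulf_neq0 ?pnatr_eq0 // subr_eq0 -natrM eqr_nat; lia.
  exists ((afun k.+2%:R)^-1 *: (2 * (m%:R - 2 * k.+1%:R) *: (Q' * 'X)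
           + afun (m%:R - k%:R) *: Q)).
    have sQ'X : size (2 * (m%:R - 2 * k.+1%:R) *: (Q' * 'X)) = k.+3.
      by rewrite size_scale // size_mulX ?sQ' // -size_poly_eq0 sQ'.
    rewrite size_scale ?invr_eq0 ?afun_neq0 // size_polyDl sQ'X //.
    by rewrite ltnS (leq_trans (size_scale_leq _ _)) // sQ.
  move=> s; apply: (mulfI (afun_neq0 F k.+1)).
  have [_ ->] := qrec s; rewrite hornerZ mulVKf ?afun_neq0 //.
  by rewrite hornerD !hornerZ hornerMX QE QE'; ring.
by move=> k; case: (H k).
Qed.

(** The 2(h+1) = m+1 values +-(1+4j), j <= h = (m-1)/2, are distinct zeros of a
polynomial of degree m+1, and a further zero would be one too many. *)
Lemma mirror_odd_zeros (F : numFieldType) m (q : F -> nat -> F) (s : F) :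
  odd m -> (forall t, mirror_rec m t (q t)) -> (forall t, q t 0%N = 1) ->
  q s m.+1 = 0 ->
  exists2 j, (j <= m./2)%N & s = (1 + 4 * j)%:R \/ s = - (1 + 4 * j)%:R.
Proof.
move=> modd qrec q0 qs0.
have [Q sQ QE] := mirror_poly modd qrec q0 m.+1.
pose pos : seq F := [seq (1 + 4 * j)%:R | j <- iota 0 (m./2).+1].
pose neg : seq F := [seq - (1 + 4 * j)%:R | j <- iota 0 (m./2).+1].
have rootQ t : t \in pos ++ neg -> root Q t.
  rewrite mem_cat rootE QE => /orP[] /mapP[j].
    rewrite mem_iota add0n ltnS => /= jm ->.
    have [sp _] := mirror_odd_spectrum modd jm (q0 (1 + 4 * j)%:R).
    by have [_ ->] := sp (qrec _).
  rewrite mem_iota add0n ltnS => /= jm ->.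
  have [_ sn] := mirror_odd_spectrum modd jm (q0 (- (1 + 4 * j)%:R)).
  by have [_ ->] := sn (qrec _).
have inj : injective (fun j => (1 + 4 * j)%:R : F).
  by move=> i j /eqP; rewrite eqr_nat => /eqP; lia.
have uniq_roots : uniq (pos ++ neg).
  rewrite cat_uniq !map_inj_uniq ?iota_uniq ?andbT //; last first.
    by move=> i j /oppr_inj/inj.
  apply/hasPn=> t /mapP[i _ ->]; apply/mapP=> -[j _].
  by move/eqP; rewrite eq_sym -subr_eq0 opprK -natrD pnatr_eq0.
have [|sN] := boolP (s \in pos ++ neg).
  rewrite mem_cat => /orP[] /mapP[j]; rewrite mem_iota add0n ltnS => /= jm ->;
    by exists j; [|auto].
have Q0 : Q != 0 by rewrite -size_poly_eq0 sQ.
have size_roots : size (s :: pos ++ neg) = m.+2.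
  by rewrite -[LHS]/(size (pos ++ neg)).+1 size_cat !size_map size_iota; lia.
have all_roots : all (root Q) (s :: pos ++ neg).
  apply/allP=> t; rewrite in_cons => /predU1P[->|/rootQ//].
  by rewrite rootE QE qs0.
have := max_poly_roots Q0 all_roots; rewrite size_roots sQ ltnn.
by rewrite cons_uniq sN uniq_roots => /(_ isT).
Qed.

Lemma mirror_odd_sg (R : realType) m (q : R[i] -> nat -> R[i]) (s : R[i]) :
  odd m -> (forall t, mirror_rec m t (q t)) -> (forall t, q t 0%N = 1) ->
  (exists2 j, (j <= m./2)%N & s = (1 + 4 * j)%:R \/ s = - (1 + 4 * j)%:R) ->
  q s m = Num.sg s /\ q s m.+1 = 0.
Proof.
move=> modd qrec q0 [j jm sE].
have [sp sn] := mirror_odd_spectrum modd jm (q0 s).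
case: sE => sE; rewrite sE in sp sn *.
  by rewrite gtr0_sg ?ltr0n //; apply: sp.
by rewrite ltr0_sg ?oppr_lt0 ?ltr0n //; apply: sn.
Qed.

Theorem theorem7p29 (R : realType) :
  [/\ palindromic_pair (P R) (fun k => ((2 * k)`!)%:R) (fun n => n%:R / 2),
      forall (n : nat) (s : R[i]), ~~ odd n -> zeros (P R) (n.+2)./2 n s ->
        (forall k : nat, ((n.+2)./2 <= k)%N -> (P R k).[s, n%:R] = 0) /\
        (forall k : nat, (k <= n./2)%N ->
           (P R k).[s, n%:R] / ((2 * k)`!)%:R
           = thetaP n s * ((P R (n./2 - k)).[s, n%:R] / ((n - 2 * k)`!)%:R)),
      forall n k : nat, n = 0 %[mod 4] -> (k <= n./2)%N ->
        forall s : R[i],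
          (P R k).[s, n%:R] / ((2 * k)`!)%:R
          = (P R (n./2 - k)).[s, n%:R] / ((n - 2 * k)`!)%:R &
      forall n k : nat, n = 2 %[mod 4] -> (k <= n./2)%N ->
        forall s : R[i], (I2plus R n `|` I2minus R n) s ->
          (P R k).[s, n%:R] / ((2 * k)`!)%:R
          = Num.sg s * ((P R (n./2 - k)).[s, n%:R] / ((n - 2 * k)`!)%:R)].
Proof.
have factN0 k : ((2 * k)`!)%:R != 0 :> R[i] by rewrite pnatr_eq0 -lt0n fact_gt0.
pose q m (s : R[i]) k := (P R k).[s, (2 * m)%:R] / ((2 * k)`!)%:R.
have qrec m s : mirror_rec m s (q m s) by exact: mirror_rec_P.
have q0 m s : q m s 0%N = 1 by rewrite /q horner_P0 muln0 divr1.
have qP m s k : (q m s k == 0) = ((P R k).[s, (2 * m)%:R] == 0).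
  by rewrite mulf_eq0 invr_eq0 (negbTE (factN0 k)) orbF.
have pal m s : q m s m.+1 = 0 ->
    (forall k, (m < k)%N -> (P R k).[s, (2 * m)%:R] = 0) /\
    (forall k, (k <= m)%N -> q m s k = q m s m * q m s (m - k)%N).
  move=> qz; split=> k km.
    by apply/eqP; rewrite -qP (mirror_tail (qrec m s)).
  by rewrite -(mirror_end (qrec m s)) ?leq_subr // subKn.
have sgn m s : odd m ->
    (exists2 j, (j <= m./2)%N & s = (1 + 4 * j)%:R \/ s = - (1 + 4 * j)%:R) ->
    q m s m = Num.sg s /\ q m s m.+1 = 0.
  by move=> modd; apply: (mirror_odd_sg modd (qrec m) (q0 m)).
have even_case m s : ~~ odd m -> q m s m = 1 /\ q m s m.+1 = 0.
  exact: mirror_even.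
have halfE n : ~~ odd n -> exists m, n = (2 * m)%N.
  by move=> nev; exists n./2; rewrite mul2n even_halfK.
have mE m : ((2 * m)./2 = m)%N by rewrite mul2n doubleK.
have mE2 m : ((2 * m).+2./2 = m.+1)%N by rewrite /= mE.
split.
- split=> [|//|n m]; first exact: P0.
  move=> nm; have {nm} -> : n = (2 * m)%N.
    apply/eqP; rewrite -(eqr_nat R) natrM -nm mulrC divfK ?pnatr_eq0 //.
  exists (fun s => q m s m); split.
    move=> s /eqP; rewrite -qP => /eqP /pal[_ /(_ 0%N)].
    rewrite q0 subn0 leq0n => /(_ isT)/esym/eqP.
    by rewrite -expr2 sqrf_eq1 => /orP[]/eqP; [left|right].
  by move=> s /eqP; rewrite -qP => /eqP /pal.
- move=> _ s /halfE[m ->]; rewrite mE2 mE => /eqP; rewrite -qP => /eqP qz.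
  have [tail palin] := pal _ _ qz; split=> // k km.
  rewrite -mulnBr -/(q m s k) -/(q m s (m - k)%N) palin //; congr (_ * _).
  rewrite /thetaP; case: (boolP (odd m)) => modd.
    rewrite ifF; last by lia.
    by have [] := sgn m s modd (mirror_odd_zeros modd (qrec m) (q0 m) qz).
  rewrite ifT; last by lia.
  by have [] := even_case m s modd.
- move=> n k n0; have [|m nE] := halfE n; first by lia.
  rewrite nE mE => km s; have [|qm qz] := even_case m s; first by lia.
  have [_ palin] := pal _ _ qz.
  by rewrite -mulnBr -/(q m s k) -/(q m s (m - k)%N) palin // qm mul1r.
- move=> n k n2; have [|m nE] := halfE n; first by lia.
  rewrite nE mE => km s sI.
  have modd : odd m by lia.
  have m4 : ((2 * m) %/ 4 = m./2)%N by lia.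
  have [|qm qz] := sgn m s modd.
    by case: sI => -[j]; rewrite m4 => jm ->; exists j => //; [left|right].
  have [_ palin] := pal _ _ qz.
  by rewrite -mulnBr -/(q m s k) -/(q m s (m - k)%N) palin // qm.
Qed.
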